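(* Let $\mathcal{C}$ be a semisimple rigid balanced braided tensor category over $\mathbb{C}$, let $A$ be a rigid $\mathcal{C}$-algebra with $\theta_A=\mathrm{id}$, and let $G$ be a compact group acting faithfully on $A$ by algebra automorphisms with $A^G=\mathbf{1}$. Then $G$ is finite.
   Context: Conventions on $\mathcal{C}$: semisimple abelian over $\mathbb{C}$, finite-dimensional Hom spaces, objects are finite direct sums of simples $L_i$, $i\in I$, unit $\mathbf{1}=L_0$ simple; braiding $\check R$; rigid; balancing $\theta$ compatible with braiding and duality (ribbon). For an object $M$ with a $G$-action, $M^G$ is defined by $\mathrm{Hom}(L_i,M^G)=\mathrm{Hom}(L_i,M)^G$. A $\mathcal{C}$-algebra is an object $A$ with an associative $\mu\colon A\otimes A\to A$, commutative ($\mu\check R_{AA}=\mu$), with a unit embedding $\iota\colon\mathbf{1}\hookrightarrow A$ and $\dim\mathrm{Hom}(\mathbf{1},A)=1$. It is rigid if the pairing $A\otimes A\xrightarrow{\mu}A\xrightarrow{\varepsilon}\mathbf{1}$ ($\varepsilon\iota=\mathrm{id}$) is nondegenerate and $\dim A\ne0$. Faithful: every $g\ne1$ in $G$ acts by a non-trivial automorphism of $A$. The action of the compact group $G$ is such that the spaces $\mathrm{Hom}(L_i,A)$ are finite-dimensional (continuous) representations of $G$. *)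

(* Defs.v *)
From HB Require Import structures.
From mathcomp Require Import all_boot all_order all_algebra complex.
From mathcomp Require Import all_classical all_reals all_analysis.
Set Implicit Arguments.
Unset Strict Implicit.
Unset Printing Implicit Defensive.
Import GRing.Theory numFieldNormedType.Exports.
Local Open Scope ring_scope.

Declare Scope cat_scope.
Delimit Scope cat_scope with cat.
Local Open Scope cat_scope.
Reserved Notation "g ∘ f" (at level 50, left associativity).
Reserved Notation "X ⊗ Y" (at level 40, left associativity).
Reserved Notation "f ⊠ g" (at level 40, left associativity).
Reserved Notation "𝟙".

(* Finite-dimensionality of Hom spaces is built into vectType. *)
Record linear_category (K : fieldType) := LinearCategory {
  obj :> Type;
  Mor : obj -> obj -> vectType K;
  id_mor : forall X, Mor X X;
  compm : forall X Y Z, Mor Y Z -> Mor X Y -> Mor X Z;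
  compmA : forall X Y Z W (h : Mor Z W) (g : Mor Y Z) (f : Mor X Y),
    compm h (compm g f) = compm (compm h g) f;
  compm_idl : forall X Y (f : Mor X Y), compm (id_mor Y) f = f;
  compm_idr : forall X Y (f : Mor X Y), compm f (id_mor X) = f;
  comp_linear_l : forall X Y Z (f : Mor X Y),
    linear (fun g : Mor Y Z => compm g f);
  comp_linear_r : forall X Y Z (g : Mor Y Z),
    linear (fun f : Mor X Y => compm g f) }.

Arguments id_mor {K l} X.
Notation "g ∘ f" := (compm g f) : cat_scope.

Section LinearCategory.
Variables (K : fieldType) (C : linear_category K).

Definition is_inverse (X Y : C) (f : Mor X Y) (g : Mor Y X) : Prop :=
  g ∘ f = id_mor X /\ f ∘ g = id_mor Y.

Definition is_isom (X Y : C) (f : Mor X Y) : Prop := exists g, is_inverse f g.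

Definition is_mono (X Y : C) (f : Mor X Y) : Prop :=
  forall (Z : C) (u v : Mor Z X), f ∘ u = f ∘ v -> u = v.

Definition is_epi (X Y : C) (f : Mor X Y) : Prop :=
  forall (Z : C) (u v : Mor Y Z), u ∘ f = v ∘ f -> u = v.

Definition is_kernel (X Y Z : C) (f : Mor X Y) (k : Mor Z X) : Prop :=
  f ∘ k = 0 /\
  forall (W : C) (h : Mor W X), f ∘ h = 0 -> exists! u : Mor W Z, k ∘ u = h.

Definition is_cokernel (X Y Z : C) (f : Mor X Y) (q : Mor Y Z) : Prop :=
  q ∘ f = 0 /\
  forall (W : C) (h : Mor Y W), h ∘ f = 0 -> exists! u : Mor Z W, u ∘ q = h.

(* X is the direct sum (biproduct) of the family Y; a zero object if n = 0. *)
Definition is_direct_sum (n : nat) (Y : 'I_n -> C) (X : C)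
    (inj : forall k, Mor (Y k) X) (proj : forall k, Mor X (Y k)) : Prop :=
  [/\ forall k, proj k ∘ inj k = id_mor (Y k),
      forall k l, k != l -> proj k ∘ inj l = 0
    & \sum_k (inj k ∘ proj k) = id_mor X].

Definition is_abelian : Prop :=
  [/\ forall n (Y : 'I_n -> C), exists X inj proj, @is_direct_sum n Y X inj proj,
      forall (X Y : C) (f : Mor X Y),
        (exists Z (k : Mor Z X), is_kernel f k) /\
        (exists Z (q : Mor Y Z), is_cokernel f q),
      forall (X Y : C) (f : Mor X Y), is_mono f ->
        exists Z (g : Mor Y Z), is_kernel g f
    & forall (X Y : C) (f : Mor X Y), is_epi f ->
        exists Z (g : Mor Z X), is_cokernel g f].

Definition is_zero_obj (X : C) : Prop := id_mor X = 0.

Definition is_simple (X : C) : Prop :=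
  ~ is_zero_obj X /\
  forall (Y : C) (j : Mor Y X), is_mono j -> is_zero_obj Y \/ is_isom j.

(* C is abelian and semisimple, with L a set of representatives of the
   isomorphism classes of simple objects. *)
Definition is_semisimple (I : Type) (L : I -> C) : Prop :=
  [/\ is_abelian,
      forall i, is_simple (L i),
      forall i j (f : Mor (L i) (L j)), is_isom f -> i = j
    & forall X : C, exists n (s : 'I_n -> I) inj proj,
        @is_direct_sum n (fun k => L (s k)) X inj proj].

End LinearCategory.

Record tensor_category (K : fieldType) := TensorCategory {
  tens_cat :> linear_category K;
  unit_obj : tens_cat;
  tens : tens_cat -> tens_cat -> tens_cat;
  tensm : forall X X' Y Y' : tens_cat,
    Mor X X' -> Mor Y Y' -> Mor (tens X Y) (tens X' Y');
  tensm_linear_l : forall (X X' Y Y' : tens_cat) (g : Mor Y Y'),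
    linear (fun f : Mor X X' => tensm f g);
  tensm_linear_r : forall (X X' Y Y' : tens_cat) (f : Mor X X'),
    linear (fun g : Mor Y Y' => tensm f g);
  tensm_id : forall X Y : tens_cat, tensm (id_mor X) (id_mor Y) = id_mor (tens X Y);
  tensm_comp : forall (X X' X'' Y Y' Y'' : tens_cat)
      (f' : Mor X' X'') (f : Mor X X') (g' : Mor Y' Y'') (g : Mor Y Y'),
    tensm (f' ∘ f) (g' ∘ g) = tensm f' g' ∘ tensm f g;
  associator : forall X Y Z, Mor (tens (tens X Y) Z) (tens X (tens Y Z));
  associatorV : forall X Y Z, Mor (tens X (tens Y Z)) (tens (tens X Y) Z);
  associatorK : forall X Y Z, is_inverse (associator X Y Z) (associatorV X Y Z);
  associator_natural : forall (X X' Y Y' Z Z' : tens_cat)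
      (f : Mor X X') (g : Mor Y Y') (h : Mor Z Z'),
    associator X' Y' Z' ∘ tensm (tensm f g) h = tensm f (tensm g h) ∘ associator X Y Z;
  lunit : forall X, Mor (tens unit_obj X) X;
  lunitV : forall X, Mor X (tens unit_obj X);
  lunitK : forall X, is_inverse (lunit X) (lunitV X);
  lunit_natural : forall (X Y : tens_cat) (f : Mor X Y),
    lunit Y ∘ tensm (id_mor unit_obj) f = f ∘ lunit X;
  runit : forall X, Mor (tens X unit_obj) X;
  runitV : forall X, Mor X (tens X unit_obj);
  runitK : forall X, is_inverse (runit X) (runitV X);
  runit_natural : forall (X Y : tens_cat) (f : Mor X Y),
    runit Y ∘ tensm f (id_mor unit_obj) = f ∘ runit X;
  tens_pentagon : forall W X Y Z,
    tensm (id_mor W) (associator X Y Z) ∘ associator W (tens X Y) Z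
      ∘ tensm (associator W X Y) (id_mor Z)
    = associator W X (tens Y Z) ∘ associator (tens W X) Y Z;
  tens_triangle : forall X Y,
    tensm (id_mor X) (lunit Y) ∘ associator X unit_obj Y = tensm (runit X) (id_mor Y) }.

Arguments unit_obj {K t}.
Notation "𝟙" := unit_obj : cat_scope.
Notation "X ⊗ Y" := (tens X Y) : cat_scope.
Notation "f ⊠ g" := (tensm f g) : cat_scope.

Section Duality.
Variables (K : fieldType) (C : tensor_category K).

(* D is a right dual of X, equivalently X is a left dual of D. *)
Definition is_duality (X D : C) (ev : Mor (D ⊗ X) 𝟙) (coev : Mor 𝟙 (X ⊗ D))
    : Prop :=
  runit X ∘ (id_mor X ⊠ ev) ∘ associator X D X ∘ (coev ⊠ id_mor X) ∘ lunitV X = id_mor X /\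
  lunit D ∘ (ev ⊠ id_mor D) ∘ associatorV D X D ∘ (id_mor D ⊠ coev) ∘ runitV D = id_mor D.

(* The morphism Y -> D attached to a pairing Y ⊗ X -> 𝟙, for D dual to X. *)
Definition transpose_pairing (X D Y : C) (coev : Mor 𝟙 (X ⊗ D))
    (e : Mor (Y ⊗ X) 𝟙) : Mor Y D :=
  lunit D ∘ (e ⊠ id_mor D) ∘ associatorV Y X D ∘ (id_mor Y ⊠ coev) ∘ runitV Y.

End Duality.

(* Semisimplicity is stated separately, by is_semisimple. *)
Record ribbon_category (K : fieldType) := RibbonCategory {
  rib_cat :> tensor_category K;

  braid : forall X Y : rib_cat, Mor (X ⊗ Y) (Y ⊗ X);
  braid_iso : forall X Y, is_isom (braid X Y);
  braid_natural : forall (X X' Y Y' : rib_cat) (f : Mor X X') (g : Mor Y Y'),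
    braid X' Y' ∘ (f ⊠ g) = (g ⊠ f) ∘ braid X Y;
  hexagon_l : forall X Y Z,
    associator Y Z X ∘ braid X (Y ⊗ Z) ∘ associator X Y Z
    = (id_mor Y ⊠ braid X Z) ∘ associator Y X Z ∘ (braid X Y ⊠ id_mor Z);
  hexagon_r : forall X Y Z,
    associatorV Z X Y ∘ braid (X ⊗ Y) Z ∘ associatorV X Y Z
    = (braid X Z ⊠ id_mor Y) ∘ associatorV X Z Y ∘ (id_mor X ⊠ braid Y Z);

  rdual : rib_cat -> rib_cat;
  ev : forall X, Mor (rdual X ⊗ X) 𝟙;
  coev : forall X, Mor 𝟙 (X ⊗ rdual X);
  ev_coev : forall X, is_duality (ev X) (coev X);
  left_dual_ex : forall X : rib_cat,
    exists (D : rib_cat) (ev' : Mor (X ⊗ D) 𝟙) (coev' : Mor 𝟙 (D ⊗ X)),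
    is_duality ev' coev';

  twist : forall X : rib_cat, Mor X X;
  twist_iso : forall X, is_isom (twist X);
  twist_natural : forall (X Y : rib_cat) (f : Mor X Y),
    twist Y ∘ f = f ∘ twist X;
  twist_unit : twist 𝟙 = id_mor 𝟙;
  twist_tens : forall X Y : rib_cat,
    twist (X ⊗ Y) = braid Y X ∘ braid X Y ∘ (twist X ⊠ twist Y);
  (* The right-hand side is the dual morphism of twist X. *)
  twist_dual : forall X : rib_cat,
    twist (rdual X)
    = transpose_pairing (coev X) (ev X ∘ (id_mor (rdual X) ⊠ twist X)) }.

Section Algebra.
Variables (K : fieldType) (C : ribbon_category K).

(* Categorical dimension, as an element of End(𝟙), which is K * id when 𝟙 is
   simple and K is algebraically closed. *)
Definition qdim (X : C) : Mor (𝟙 : C) 𝟙 :=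
  ev X ∘ braid X (rdual X) ∘ (twist X ⊠ id_mor (rdual X)) ∘ coev X.

Record algebra := BuildAlgebra {
  alg_obj :> C;
  alg_mul : Mor (alg_obj ⊗ alg_obj) alg_obj;
  alg_unit : Mor 𝟙 alg_obj;
  alg_mul_assoc : alg_mul ∘ (alg_mul ⊠ id_mor alg_obj)
    = alg_mul ∘ (id_mor alg_obj ⊠ alg_mul) ∘ associator alg_obj alg_obj alg_obj;
  alg_mul_comm : alg_mul ∘ braid alg_obj alg_obj = alg_mul;
  alg_mul_unit_l : alg_mul ∘ (alg_unit ⊠ id_mor alg_obj) = lunit alg_obj;
  alg_mul_unit_r : alg_mul ∘ (id_mor alg_obj ⊠ alg_unit) = runit alg_obj;
  alg_unit_mono : is_mono alg_unit;
  dim_hom_unit : \dim {: Mor 𝟙 alg_obj} = 1%N }.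

Definition nondegenerate_pairing (X Y : C) (e : Mor (Y ⊗ X) 𝟙) : Prop :=
  is_isom (transpose_pairing (coev X) e).

Definition rigid_algebra (A : algebra) : Prop :=
  (exists eps : Mor A 𝟙, eps ∘ alg_unit A = id_mor 𝟙 /\ nondegenerate_pairing (eps ∘ alg_mul A)) /\
  qdim A <> 0.

Definition algebra_action (G : groupType) (A : algebra) (act : G -> Mor A A)
    : Prop :=
  [/\ act 1%g = id_mor A,
      forall g h, act (g * h)%g = act g ∘ act h,
      forall g, act g ∘ alg_mul A = alg_mul A ∘ (act g ⊠ act g)
    & forall g, act g ∘ alg_unit A = alg_unit A].

Definition faithful_action (G : groupType) (X : C) (act : G -> Mor X X) : Prop :=
  forall g : G, g <> 1%g -> act g <> id_mor X.

(* j : N -> X exhibits N as X^G: composition with j identifies Hom(L_i, N)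
   with Hom(L_i, X)^G for all i. *)
Definition is_invariants (I : Type) (L : I -> C) (G : groupType) (X N : C)
    (act : G -> Mor X X) (j : Mor N X) : Prop :=
  forall i : I,
    (forall (f : Mor (L i) N) (g : G), act g ∘ (j ∘ f) = j ∘ f) /\
    (forall phi : Mor (L i) X, (forall g : G, act g ∘ phi = phi) ->
       exists! f : Mor (L i) N, j ∘ f = phi).

End Algebra.

HB.mixin Record isTopologicalGroup G of Group G & Topological G := {
  mulg_continuous : continuous (fun x : G * G => (x.1 * x.2)%g);
  invg_continuous : continuous (fun x : G => (x^-1)%g) }.

#[short(type="topologicalGroupType")]
HB.structure Definition TopologicalGroup :=
  {G of isTopologicalGroup G & Group G & Topological G}.

Section ContinuousAction.
Variables (R : realType) (C : ribbon_category R[i]).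

Definition hom_rep (G : groupType) (X Y : C) (act : G -> Mor X X) (g : G)
    : 'End(Mor Y X) :=
  linfun (fun f : Mor Y X => act g ∘ f).

(* Continuity of the matrix of the representation of G on each Hom(L_i, X);
   ^o gives R[i] its usual topology. *)
Definition continuous_action (I : Type) (L : I -> C) (G : topologicalGroupType)
    (X : C) (act : G -> Mor X X) : Prop :=
  forall i : I,
    let e := vbasis {: Mor (L i) X} in
    continuous (fun g : G =>
      passmx.mxof e e (hom_rep (L i) act g)
        : 'M[R[i]^o]_(\dim {: Mor (L i) X})).

End ContinuousAction.

(* Main.v *)
From HB Require Import structures.
Require Import Defs.
From mathcomp Require Import all_boot all_order all_algebra complex.
From mathcomp Require Import all_classical all_reals all_analysis.
Local Open Scope classical_set_scope.
Local Open Scope ring_scope.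
Local Open Scope cat_scope.
Set Implicit Arguments.
Unset Strict Implicit.
Import GRing.Theory.

(** The reason is Dedekind's independence of characters, transported to the
algebra A: distinct automorphisms of A are linearly independent in the
finite-dimensional space End(A), so a group acting faithfully on A by
automorphisms has at most dim End(A) elements.

Write m for the multiplication, e = eps m for the nondegenerate pairing, and c
for the copairing that makes A its own dual through e, so that c is the
Casimir element of the Frobenius algebra A. For endomorphisms g, h of A put
B(g, h) = m (g ⊠ h) c : 𝟙 -> A. This is bilinear, and takes values in the line
spanned by the unit of A, because Hom(𝟙, A) is one-dimensional.

If g and h are automorphisms, pushing an element of A through the Casimir
element (lemma frobenius) yields g(a) B(g, h) = B(g, h) h(a) for all a
(conv_intertwines). As B(g, h) is a multiple x of the unit, this reads
x g = x h, hence B(g, h) = 0 as soon as g and h differ. On the diagonal,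
B(g, g) = g (m c) = m c, which is the dimension of A times the unit: this is
where commutativity and the triviality of the twist enter, to identify e c
with the quantum dimension (selfdual_of_nondegenerate). As the dimension of A
is not zero, the automorphisms form an orthogonal family of non-isotropic
vectors for B, and such a family is linearly independent.

Since the monoidal structure is not strict, the graphical identities involved
rest on coherence: the classical derivation of Kelly's unit identities from
the pentagon and the triangle, and two forms of the zigzag identities for a
duality tensored on the left with a further object. *)

(** * Linear categories *)

Section Composition.
Variables (K : fieldType) (C : linear_category K).

(** Compositions are kept in right-associated form; this lets an equation
between composites of two morphisms be applied inside a longer composite. *)
Lemma reassoc (X Y Z W : C) (g : Mor Y Z) (f : Mor X Y) (h : Mor X Z)
    (u : Mor W X) : g ∘ f = h -> g ∘ (f ∘ u) = h ∘ u.
Proof. by move=> <-; rewrite compmA. Qed.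

Lemma isom_epi (X Y Z : C) (f : Mor X Y) (g : Mor Y X) (u v : Mor Y Z) :
  is_inverse f g -> u ∘ f = v ∘ f -> u = v.
Proof.
move=> [_ fg] /(congr1 (fun w => w ∘ g)).
by rewrite -!compmA fg !compm_idr.
Qed.

Lemma isom_mono (X Y Z : C) (f : Mor X Y) (g : Mor Y X) (u v : Mor Z X) :
  is_inverse f g -> f ∘ u = f ∘ v -> u = v.
Proof.
move=> [gf _] /(congr1 (fun w => g ∘ w)).
by rewrite !compmA gf !compm_idl.
Qed.

HB.instance Definition _ (X Y Z : C) (f : Mor Y Z) :=
  GRing.isLinear.Build _ _ _ _ (@compm K C X Y Z f) (comp_linear_r f).

End Composition.

(** * Coherence in monoidal categories *)

Section Coherence.
Variables (K : fieldType) (C : tensor_category K).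
Implicit Types X Y Z W : C.

Local Notation id := id_mor.

Lemma tensm_compl X X' X'' Y (f : Mor X' X'') (g : Mor X X') :
  (f ∘ g) ⊠ id Y = (f ⊠ id Y) ∘ (g ⊠ id Y).
Proof. by rewrite -tensm_comp compm_idl. Qed.

Lemma tensm_compr X Y Y' Y'' (f : Mor Y' Y'') (g : Mor Y Y') :
  id X ⊠ (f ∘ g) = (id X ⊠ f) ∘ (id X ⊠ g).
Proof. by rewrite -tensm_comp compm_idl. Qed.

Lemma tensm_swap X X' Y Y' (f : Mor X X') (g : Mor Y Y') :
  (f ⊠ id Y') ∘ (id X ⊠ g) = (id X' ⊠ g) ∘ (f ⊠ id Y).
Proof. by rewrite -!tensm_comp !compm_idl !compm_idr. Qed.

Lemma associatorV_natural X X' Y Y' Z Z' (f : Mor X X') (g : Mor Y Y')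
    (h : Mor Z Z') :
  associatorV X' Y' Z' ∘ (f ⊠ (g ⊠ h)) = ((f ⊠ g) ⊠ h) ∘ associatorV X Y Z.
Proof.
have [K1 _] := associatorK X' Y' Z'; have [_ K2] := associatorK X Y Z.
rewrite -[LHS]compm_idr -K2 -!compmA (reassoc _ (esym (associator_natural f g h))).
by rewrite -!compmA (reassoc _ K1) compm_idl.
Qed.

Lemma lunitV_natural X Y (f : Mor X Y) : lunitV Y ∘ f = (id 𝟙 ⊠ f) ∘ lunitV X.
Proof.
have [K1 _] := lunitK Y; have [_ K2] := lunitK X.
rewrite -[LHS]compm_idr -K2 -!compmA (reassoc _ (esym (lunit_natural f))).
by rewrite -!compmA (reassoc _ K1) compm_idl.
Qed.

Lemma runitV_natural X Y (f : Mor X Y) : runitV Y ∘ f = (f ⊠ id 𝟙) ∘ runitV X.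
Proof.
have [K1 _] := runitK Y; have [_ K2] := runitK X.
rewrite -[LHS]compm_idr -K2 -!compmA (reassoc _ (esym (runit_natural f))).
by rewrite -!compmA (reassoc _ K1) compm_idl.
Qed.

Lemma tensm1_inj X Y (f g : Mor X Y) : f ⊠ id 𝟙 = g ⊠ id 𝟙 -> f = g.
Proof.
move=> fg; apply: (isom_epi (runitK X)).
by rewrite -!runit_natural fg.
Qed.

Lemma tens1m_inj X Y (f g : Mor X Y) : id 𝟙 ⊠ f = id 𝟙 ⊠ g -> f = g.
Proof.
move=> fg; apply: (isom_epi (lunitK X)).
by rewrite -!lunit_natural fg.
Qed.

Lemma is_inverse_comp X Y Z (f : Mor X Y) f' (g : Mor Y Z) g' :
  is_inverse f f' -> is_inverse g g' -> is_inverse (g ∘ f) (f' ∘ g').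
Proof.
move=> [f1 f2] [g1 g2]; split; rewrite -!compmA.
  by rewrite (reassoc _ g1) compm_idl.
by rewrite (reassoc _ f2) compm_idl.
Qed.

Lemma is_inverse_tensl X Y Z (f : Mor X Y) f' :
  is_inverse f f' -> is_inverse (f ⊠ id Z) (f' ⊠ id Z).
Proof.
by move=> [f1 f2]; split; rewrite -tensm_compl ?f1 ?f2 tensm_id.
Qed.

(** Kelly's identity: tensoring with 𝟙 on the left is faithful, and after
tensoring and composing with suitable associators both sides become the two
legs of a pentagon with triangles attached. *)
Lemma lunit_tens X Y : lunit (X ⊗ Y) ∘ associator 𝟙 X Y = lunit X ⊠ id Y.
Proof.
apply: tens1m_inj.
apply: (isom_epi (is_inverse_comp (is_inverse_tensl Y (associatorK 𝟙 𝟙 X))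
                  (associatorK 𝟙 (𝟙 ⊗ X) Y))).
rewrite tensm_compr -!compmA (compmA (_ ⊠ associator _ _ _)) tens_pentagon.
rewrite compmA compmA tens_triangle -tensm_id -associator_natural -tens_triangle.
by rewrite tensm_compl compmA associator_natural -!compmA.
Qed.

(** The mirror image of lunit_tens, with 𝟙 tensored on the right. *)
Lemma runit_tens X Y : runit (X ⊗ Y) = (id X ⊠ runit Y) ∘ associator X Y 𝟙.
Proof.
apply: tensm1_inj; apply: (isom_mono (associatorK X Y 𝟙)).
rewrite -tens_triangle tensm_compl !compmA.
rewrite -(tensm_id X Y) !associator_natural -compmA -tens_pentagon.
by rewrite !compmA -tensm_compr tens_triangle.
Qed.

(** The triangle identity at 𝟙 expresses 1 ⊠ lunit 𝟙, and runit_tens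
expresses 1 ⊠ runit 𝟙, through runit 𝟙 ⊠ 1 = runit (𝟙 ⊗ 𝟙). *)
Lemma lunit_runit1 : lunit 𝟙 = runit (𝟙 : C).
Proof.
apply: tens1m_inj; apply: (isom_epi (associatorK 𝟙 𝟙 𝟙)).
rewrite tens_triangle -runit_tens.
by apply: (isom_mono (runitK 𝟙)); rewrite runit_natural.
Qed.

Lemma tens_triangleV X Y :
  associator X 𝟙 Y ∘ (runitV X ⊠ id Y) = id X ⊠ lunitV Y.
Proof.
have [lK _] := lunitK Y; have [_ rK] := runitK X.
rewrite -[LHS]compm_idl -tensm_id -lK tensm_compr.
rewrite -compmA (compmA (_ ⊠ lunit _)) tens_triangle -tensm_compl rK tensm_id.
by rewrite compm_idr.
Qed.

Lemma lunitV_tens X Y : associator 𝟙 X Y ∘ (lunitV X ⊠ id Y) = lunitV (X ⊗ Y).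
Proof.
apply: (isom_mono (lunitK _)).
rewrite compmA lunit_tens -tensm_compl (proj2 (lunitK _)) (proj2 (lunitK _)).
exact: tensm_id.
Qed.

Lemma runitV_tens X Y : associator X Y 𝟙 ∘ runitV (X ⊗ Y) = id X ⊠ runitV Y.
Proof.
rewrite -[LHS]compm_idl -tensm_id -(proj1 (runitK Y)) tensm_compr.
rewrite -compmA (compmA (_ ⊠ runit _)) -runit_tens (proj2 (runitK _)).
by rewrite compm_idr.
Qed.

Lemma runit_tensV X Y : runit (X ⊗ Y) ∘ associatorV X Y 𝟙 = id X ⊠ runit Y.
Proof. by rewrite runit_tens -compmA (proj2 (associatorK _ _ _)) compm_idr. Qed.

Lemma triangle_V X Y : (runit X ⊠ id Y) ∘ associatorV X 𝟙 Y = id X ⊠ lunit Y.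
Proof. by rewrite -tens_triangle -compmA (proj2 (associatorK _ _ _)) compm_idr. Qed.

Lemma pentagon_r W X Y Z :
  associator (W ⊗ X) Y Z ∘ (associatorV W X Y ⊠ id Z)
  = associatorV W X (Y ⊗ Z) ∘ (id W ⊠ associator X Y Z) ∘ associator W (X ⊗ Y) Z.
Proof.
apply: (isom_epi (is_inverse_tensl Z (associatorK W X Y))).
apply: (isom_mono (associatorK W X (Y ⊗ Z))).
rewrite -!compmA -tensm_compl (proj1 (associatorK _ _ _)) tensm_id compm_idr.
rewrite -tens_pentagon (reassoc _ (proj2 (associatorK _ _ _))) compm_idl.
by rewrite compmA.
Qed.

Lemma pentagon_l W X Y Z :
  (associator W X Y ⊠ id Z) ∘ associatorV (W ⊗ X) Y Z
  = associatorV W (X ⊗ Y) Z ∘ (id W ⊠ associatorV X Y Z) ∘ associator W X (Y ⊗ Z).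
Proof.
apply: (isom_epi (associatorK (W ⊗ X) Y Z)).
rewrite -!compmA (proj1 (associatorK _ _ _)) compm_idr -tens_pentagon.
rewrite -compmA (reassoc (h := id _) _); last first.
  by rewrite -tensm_compr (proj1 (associatorK _ _ _)) tensm_id.
by rewrite compm_idl (reassoc _ (proj1 (associatorK _ _ _))) compm_idl.
Qed.

(** * Dualities *)

(** A string of Y ⊗ X through which the unit is inserted between Y and X,
then c, then e: only X and its dual are involved, so the result is the zigzag
of X next to an idle Y. *)
Lemma tensor_snake_ev Y X D (e : Mor (D ⊗ X) 𝟙) (c : Mor 𝟙 (X ⊗ D)) :
  runit (Y ⊗ X) ∘ (id (Y ⊗ X) ⊠ e) ∘ associator (Y ⊗ X) D X
    ∘ (associatorV Y X D ⊠ id X) ∘ ((id Y ⊠ c) ⊠ id X) ∘ (runitV Y ⊠ id X)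
  = id Y ⊠ (runit X ∘ (id X ⊠ e) ∘ associator X D X ∘ (c ⊠ id X) ∘ lunitV X).
Proof.
rewrite -!compmA (reassoc _ (pentagon_r _ _ _ _)) -!compmA.
rewrite (reassoc _ (associator_natural _ _ _)) -compmA tens_triangleV.
rewrite -(tensm_id Y X) (reassoc _ (esym (associatorV_natural _ _ _))) -!compmA.
by rewrite (reassoc _ (runit_tensV _ _)) !tensm_compr.
Qed.

(** The other zigzag next to an idle Y. *)
Lemma tensor_snake_coev Y X D (e : Mor (X ⊗ D) 𝟙) (c : Mor 𝟙 (D ⊗ X)) :
  (runit Y ⊠ id X) ∘ ((id Y ⊠ e) ⊠ id X) ∘ (associator Y X D ⊠ id X)
    ∘ associatorV (Y ⊗ X) D X ∘ (id (Y ⊗ X) ⊠ c) ∘ runitV (Y ⊗ X)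
  = id Y ⊠ (lunit X ∘ (e ⊠ id X) ∘ associatorV X D X ∘ (id X ⊠ c) ∘ runitV X).
Proof.
rewrite -!compmA (reassoc _ (pentagon_l _ _ _ _)) -!compmA.
rewrite -(tensm_id Y X) (reassoc _ (associator_natural _ _ _)) -compmA runitV_tens.
rewrite (reassoc _ (esym (associatorV_natural _ _ _))) -!compmA.
by rewrite (reassoc _ (triangle_V _ _)) !tensm_compr.
Qed.

(** Transposition turns a pairing p into a map from Y to the dual of X;
evaluating the result straightens the bend in X and returns p. *)
Lemma transpose_pairingK X D Y (e : Mor (D ⊗ X) 𝟙) (c : Mor 𝟙 (X ⊗ D))
    (p : Mor (Y ⊗ X) 𝟙) :
  is_duality e c -> e ∘ (transpose_pairing c p ⊠ id X) = p.
Proof.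
move=> [zig _]; rewrite /transpose_pairing !tensm_compl.
(* Slide e and p past each other, so that only the zigzag acts on Y ⊗ X. *)
rewrite -!lunit_tens !compmA -lunit_natural -(compmA (lunit 𝟙)).
rewrite -(compmA (lunit 𝟙)) -(compmA (lunit 𝟙)) lunit_runit1.
rewrite -!compmA (reassoc _ (associator_natural _ _ _)) tensm_id -!compmA.
rewrite (reassoc _ (esym (tensm_swap _ _))) -!compmA.
rewrite (reassoc _ (runit_natural _)) -!compmA.
have := tensor_snake_ev Y e c; rewrite -!compmA => ->.
by rewrite !compmA zig tensm_id compm_idr.
Qed.

(** Bending the leg D of a morphism down with e loses no information, since c
bends it back up. *)
Lemma duality_flat_inj X Y D W (e : Mor (D ⊗ X) 𝟙) (c : Mor 𝟙 (X ⊗ D))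
    (f g : Mor W (Y ⊗ D)) : is_duality e c ->
  (id Y ⊠ e) ∘ associator Y D X ∘ (f ⊠ id X)
  = (id Y ⊠ e) ∘ associator Y D X ∘ (g ⊠ id X) -> f = g.
Proof.
move=> [_ zig].
have flatK (u : Mor W (Y ⊗ D)) : u = (runit Y ⊠ id D)
    ∘ (((id Y ⊠ e) ∘ associator Y D X ∘ (u ⊠ id X)) ⊠ id D)
    ∘ associatorV W X D ∘ (id W ⊠ c) ∘ runitV W.
  have := tensor_snake_coev Y e c; rewrite zig tensm_id => snake.
  rewrite -[LHS]compm_idl -snake !tensm_compl -!compmA runitV_natural.
  rewrite (reassoc _ (esym (tensm_swap _ _))) -!compmA.
  by rewrite -(tensm_id X D) (reassoc _ (associatorV_natural _ _ _)) -!compmA.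
by move=> fg; rewrite [f]flatK fg -flatK.
Qed.

(** An element of X can be multiplied into either leg of the copairing c with
the same result. Both sides bend down to m: the left one by a zigzag alone, the
right one by invariance of e followed by a zigzag. *)
Lemma frobenius X (m : Mor (X ⊗ X) X) (e : Mor (X ⊗ X) 𝟙) (c : Mor 𝟙 (X ⊗ X)) :
    is_duality e c ->
    e ∘ (m ⊠ id X) = e ∘ (id X ⊠ m) ∘ associator X X X ->
  (m ⊠ id X) ∘ associatorV X X X ∘ (id X ⊠ c) ∘ runitV X
  = (id X ⊠ m) ∘ associator X X X ∘ (c ⊠ id X) ∘ lunitV X.
Proof.
move=> dual inv; apply: (duality_flat_inj dual).
apply: (isom_mono (runitK X)).
transitivity m.
  rewrite !tensm_compl -!compmA.
  rewrite (reassoc _ (associator_natural _ _ _)) -!compmA tensm_id.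
  rewrite (reassoc _ (esym (tensm_swap _ _))) -!compmA.
  rewrite (reassoc _ (runit_natural _)) -!compmA.
  have := tensor_snake_ev X e c; rewrite -!compmA => ->.
  by have := dual.1; rewrite -!compmA => ->; rewrite tensm_id compm_idr.
rewrite !tensm_compl -!compmA.
rewrite (reassoc _ (associator_natural _ _ _)) -!compmA.
(* Invariance of e moves the multiplication off the leg of c. *)
rewrite (reassoc _ (esym (tensm_compr _ _ _))) inv !tensm_compr -!compmA.
have := tens_pentagon X X X X; rewrite -!compmA.
move=> /(congr1 (fun u => u ∘ ((c ⊠ id X) ⊠ id X) ∘ (lunitV X ⊠ id X))).
rewrite -!compmA => ->.
rewrite (reassoc _ (associator_natural _ _ _)) tensm_id -!compmA lunitV_tens.
rewrite (reassoc _ (esym (associator_natural _ _ _))) -!compmA tensm_id.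
rewrite (reassoc _ (esym (tensm_swap _ _))) -!compmA -lunitV_natural.
by have := dual.1; rewrite !compmA => ->; rewrite compm_idl.
Qed.

End Coherence.

(** * Orthogonal families *)

(** An infinite family would contain one more independent vector than the
dimension of V; applying B j to a linear relation isolates its j-th
coefficient. *)
Lemma finite_orthogonal_family (K : fieldType) (V W : vectType K) (T : Type)
    (v : T -> V) (B : T -> {linear V -> W}) :
    (forall i, B i (v i) != 0) ->
    (forall i j, i <> j -> B j (v i) = 0) ->
  finite_set [set: T].
Proof.
elim/Ppointed: T => T in v B *; first by rewrite emptyE.
move=> Bii Bij; apply: contrapT => /infiniteP/pcard_injP[s s_inj].
pose n := (\dim {: V}).+1; pose X := [tuple v (s i) | i < n].
suff /eqP dimX : free X.
  have := dimvS (subvf <<X>>%VS); rewrite dimX size_tuple.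
  by rewrite ltnn.
apply/freeP => k; under eq_bigr do rewrite -tnth_nth tnth_mktuple.
move=> sum0 j.
have := congr1 (B (s j)) sum0; rewrite linear0 linear_sum (bigD1 j) //=.
rewrite big1 => [|i i_j]; last first.
  rewrite linearZ_LR Bij ?scaler0 // => /s_inj sij.
  by case/eqP: i_j; apply: val_inj; apply: sij; rewrite inE.
rewrite addr0 linearZ_LR => /eqP.
by rewrite scaler_eq0 (negPf (Bii _)) orbF => /eqP.
Qed.

(** * Automorphisms of rigid algebras *)

Section Algebra.
Variables (K : fieldType) (C : ribbon_category K).
Local Notation id := id_mor.

(** The copairing is the coevaluation of X with its dual leg carried back to X
by the inverse of the isomorphism that e induces. Naturality of the braiding
then turns the loop of c closed by e into the loop computing the dimension of X
when its twist is trivial. *)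
Lemma selfdual_of_nondegenerate (X : C) (e : Mor (X ⊗ X) 𝟙) :
    nondegenerate_pairing e ->
  exists c : Mor 𝟙 (X ⊗ X), is_duality e c
    /\ e ∘ braid X X ∘ c = ev X ∘ braid X (rdual X) ∘ coev X.
Proof.
move=> [v [vp pv]]; set p := transpose_pairing _ _ in vp pv.
have eE := transpose_pairingK e (ev_coev X); rewrite -/p in eE.
have [zig _] := ev_coev X.
exists ((id X ⊠ v) ∘ coev X); split; first split.
- rewrite -[RHS]zig -eE tensm_compl tensm_compr -!compmA.
  rewrite (reassoc _ (associator_natural _ _ _)) -!compmA.
  rewrite (reassoc (f := id X ⊠ (v ⊠ id X)) (h := id _) _) ?compm_idl //.
  by rewrite -tensm_compr -tensm_compl pv !tensm_id.
- rewrite tensm_compr -!compmA (reassoc _ (associatorV_natural _ _ _)) -!compmA.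
  rewrite tensm_id (reassoc _ (tensm_swap _ _)) -!compmA.
  rewrite (reassoc _ (lunit_natural _)) -!compmA -[RHS]vp /p /transpose_pairing.
  by rewrite -!compmA.
- rewrite -eE -!compmA (reassoc _ (braid_natural _ _)) -!compmA.
  by rewrite (reassoc _ (esym (tensm_compl _ _ _))) pv tensm_id compm_idl.
Qed.

(** The convolution product of g and h, evaluated at 𝟙: for a Frobenius
algebra X with Casimir element c it is the value B(g, h) of the form for which
automorphisms are orthogonal. The argument g comes last because the form is
used as a linear map in g, indexed by h. *)
Definition conv (X : C) (m : Mor (X ⊗ X) X) (c : Mor 𝟙 (X ⊗ X)) (h g : Mor X X)
  : Mor 𝟙 X := m ∘ (g ⊠ h) ∘ c.

Lemma conv_linear X m c h : linear (@conv X m c h).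
Proof.
move=> a f g; rewrite /conv tensm_linear_l.
by rewrite [m ∘ _]linearP [LHS]comp_linear_l.
Qed.

HB.instance Definition _ X m c h :=
  GRing.isLinear.Build _ _ _ _ (@conv X m c h) (@conv_linear X m c h).

(** The element x = B(g, h) satisfies g(a) x = x h(a). Associativity and
multiplicativity of g bring the left side to m (g ⊠ h) applied to a multiplied
into the first leg of c, those of h bring the right side to the same with the
second leg; frobenius identifies the two. *)
Lemma conv_intertwines (A : algebra C) (e : Mor (A ⊗ A) 𝟙) (c : Mor 𝟙 (A ⊗ A))
    (g h : Mor A A) :
    is_duality e c ->
    e ∘ (alg_mul A ⊠ id A) = e ∘ (id A ⊠ alg_mul A) ∘ associator A A A ->
    g ∘ alg_mul A = alg_mul A ∘ (g ⊠ g) ->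
    h ∘ alg_mul A = alg_mul A ∘ (h ⊠ h) ->
  alg_mul A ∘ (g ⊠ conv (alg_mul A) c h g) ∘ runitV A
  = alg_mul A ∘ (conv (alg_mul A) c h g ⊠ h) ∘ lunitV A.
Proof.
move=> dual inv gM hM; rewrite /conv.
set m := alg_mul A in inv gM hM *.
have mA : m ∘ (m ⊠ id A) = m ∘ (id A ⊠ m) ∘ associator A A A
  := alg_mul_assoc A.
have -> : g ⊠ (m ∘ (g ⊠ h) ∘ c)
    = (id A ⊠ m) ∘ (g ⊠ (g ⊠ h)) ∘ (id A ⊠ c).
  by rewrite -!tensm_comp compm_idl compm_idr.
have -> : (m ∘ (g ⊠ h) ∘ c) ⊠ h = (m ⊠ id A) ∘ ((g ⊠ h) ⊠ h) ∘ (c ⊠ id A).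
  by rewrite -!tensm_comp compm_idl compm_idr.
transitivity (m ∘ (g ⊠ h) ∘ ((m ⊠ id A) ∘ associatorV A A A ∘ (id A ⊠ c) ∘ runitV A)).
  have mAV : m ∘ (id A ⊠ m) = m ∘ (m ⊠ id A) ∘ associatorV A A A.
    by rewrite mA -!compmA (proj2 (associatorK _ _ _)) compm_idr.
  rewrite -!compmA (reassoc _ mAV) -!compmA (reassoc _ (associatorV_natural _ _ _)).
  rewrite -!compmA (reassoc _ (esym (tensm_comp _ _ _ _))).
  by rewrite (reassoc _ (esym (tensm_comp _ _ _ _))) compm_idl compm_idr gM.
rewrite (frobenius dual inv) -!compmA (reassoc _ mA) -!compmA.
rewrite (reassoc _ (associator_natural _ _ _)) -!compmA.
rewrite (reassoc _ (esym (tensm_comp _ _ _ _))).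
by rewrite (reassoc _ (esym (tensm_comp _ _ _ _))) compm_idl compm_idr hM.
Qed.

Lemma hom_unitE (A : algebra C) (x : Mor 𝟙 A) :
  alg_unit A != 0 -> exists a, x = a *: alg_unit A.
Proof.
move=> u0; apply/vlineP.
suff -> : <[alg_unit A]>%VS = {: Mor 𝟙 A}%VS by exact: memvf.
by apply/eqP; rewrite eqEdim subvf dim_vline u0 dim_hom_unit.
Qed.

Lemma mul_scaled_unit_r (A : algebra C) (g : Mor A A) (a : K) :
  alg_mul A ∘ (g ⊠ (a *: alg_unit A)) ∘ runitV A = a *: g.
Proof.
rewrite (scalable_linear (tensm_linear_r g)) linearZ_LR.
rewrite (scalable_linear (comp_linear_l _)); congr (_ *: _).
have -> : g ⊠ alg_unit A = (id A ⊠ alg_unit A) ∘ (g ⊠ id 𝟙).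
  by rewrite -tensm_comp compm_idl compm_idr.
rewrite -!compmA -runitV_natural (reassoc _ (alg_mul_unit_r A)).
by rewrite compmA (proj2 (runitK A)) compm_idl.
Qed.

Lemma mul_scaled_unit_l (A : algebra C) (h : Mor A A) (a : K) :
  alg_mul A ∘ ((a *: alg_unit A) ⊠ h) ∘ lunitV A = a *: h.
Proof.
rewrite (scalable_linear (tensm_linear_l h)) linearZ_LR.
rewrite (scalable_linear (comp_linear_l _)); congr (_ *: _).
have -> : alg_unit A ⊠ h = (alg_unit A ⊠ id A) ∘ (id 𝟙 ⊠ h).
  by rewrite -tensm_comp compm_idl compm_idr.
rewrite -!compmA -lunitV_natural (reassoc _ (alg_mul_unit_l A)).
by rewrite compmA (proj2 (lunitK A)) compm_idl.
Qed.

(** The automorphisms by which G acts are pairwise orthogonal and non-isotropic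
for conv, and faithfulness makes them distinct. *)
Lemma finite_faithful_action (A : algebra C) (G : groupType) (act : G -> Mor A A) :
    rigid_algebra A -> twist A = id A ->
    algebra_action act -> faithful_action act ->
  finite_set [set: G].
Proof.
move=> [[eps [epsK nondeg]] dimA] twA [act1 actM actmul actunit] faith.
have unit0 : alg_unit A != 0.
  apply: contra_notN dimA => /eqP u0.
  by rewrite -[LHS]compm_idr -epsK u0 !linear0.
have [c [dual braid_c]] := selfdual_of_nondegenerate nondeg.
have inv : (eps ∘ alg_mul A) ∘ (alg_mul A ⊠ id A)
    = (eps ∘ alg_mul A) ∘ (id A ⊠ alg_mul A) ∘ associator A A A.
  by rewrite -!compmA alg_mul_assoc !compmA.
have [d mc] := hom_unitE (alg_mul A ∘ c) unit0.
(* The scalar d is the dimension of A. *)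
have d0 : d != 0.
  apply: contra_notN dimA => /eqP d0; rewrite /qdim twA tensm_id compm_idr.
  by rewrite -braid_c -(compmA eps) alg_mul_comm -compmA mc d0 scale0r linear0.
have act_inj (g h : G) : act g = act h -> g = h.
  move=> gh; have gh1 : act (g / h)%g = id A by rewrite actM gh -actM mulgV act1.
  by apply: contrapT => g_h; apply: (faith (g / h)%g) gh1 => /divg1_eq.
apply: (@finite_orthogonal_family K _ _ G act
  (fun h => conv (alg_mul A) c (act h) : {linear _ -> _})) => [g|g h g_h] /=.
  by rewrite /conv -actmul -compmA mc linearZ_LR /= actunit scaler_eq0 negb_or d0.
have [x xE] := hom_unitE (conv (alg_mul A) c (act h) (act g)) unit0.
have := conv_intertwines dual inv (actmul g) (actmul h).
rewrite xE mul_scaled_unit_r mul_scaled_unit_l => /eqP.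
rewrite -subr_eq0 -scalerBr scaler_eq0 subr_eq0 => /orP[/eqP ->|/eqP/act_inj //].
by rewrite scale0r.
Qed.

End Algebra.

Theorem corollary2p12 (R : realType) (C : ribbon_category R[i])
    (I : Type) (L : I -> C) (i0 : I)
    (ssC : is_semisimple L) (L0 : L i0 = 𝟙)
    (A : algebra C) (rigA : rigid_algebra A) (twA : twist A = id_mor A)
    (G : topologicalGroupType)
    (cptG : compact [set: G]) (hausG : hausdorff_space G)
    (act : G -> Mor A A)
    (actA : algebra_action act) (faithA : faithful_action act)
    (contA : continuous_action L act)
    (invA : is_invariants L act (alg_unit A)) :
  finite_set [set: G].
Proof. exact: finite_faithful_action rigA twA actA faithA. Qed.
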